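(* There exists an Elgot monad $\mathbb{T}$ on $\mathbf{Set}$ whose Kleisli category is enriched over bounded join-semilattices and strict join-preserving maps and which satisfies $(\eta\circ\mathrm{inl}\lor\eta\circ\mathrm{inr})^\dagger=\eta$, but which fails Strong Uniformity (and hence is not a Kleene monad).
   Context: Elgot monad: a monad $(T,\eta,(\cdot)^\sharp)$ with Kleisli composition $g\cdot f=g^\sharp\circ f$, equipped with $(\cdot)^\dagger:\mathbf{Set}(X,T(Y+X))\to\mathbf{Set}(X,TY)$ satisfying Fixpoint $[\eta,f^\dagger]\cdot f=f^\dagger$; Naturality $g\cdot f^\dagger=([T\mathrm{inl}\circ g,\eta\circ\mathrm{inr}]\cdot f)^\dagger$ for $g:Y\to TZ$; Codiagonal $f^{\dagger\dagger}=([\eta,\eta\circ\mathrm{inr}]\cdot f)^\dagger$ for $f:X\to T((Y+X)+X)$; Uniformity: for functions $h:X\to Z$, $g:Z\to T(Y+Z)$, $f:X\to T(Y+X)$, if $g\circ h=T(\mathrm{id}+h)\circ f$ then $g^\dagger\circ h=f^\dagger$. $\delta=(\eta\circ\mathrm{inr})^\dagger$. Strong Uniformity: for all $h:X\to TZ$, $g:Z\to T(Y+Z)$, $f:X\to T(Y+X)$: if $\delta\cdot h=\delta$ and $g\cdot h=[\eta\circ\mathrm{inl},\eta\circ\mathrm{inr}\cdot h]\cdot f$, then $g^\dagger\cdot h=f^\dagger$. Enrichment over bounded join-semilattices and strict join-preserving maps: each $\mathbf{Set}(X,TY)$ is a join-semilattice with least element, and Kleisli composition preserves binary joins and the least element in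 each argument. A Kleene monad is a monad whose Kleisli category is so enriched and carries an operator $(\cdot)^\ast$ on endo-hom-sets with $g\cdot f^\ast$ the least prefixpoint of $x\mapsto g\lor x\cdot f$ and $f^\ast\cdot h$ the least prefixpoint of $x\mapsto h\lor f\cdot x$. *)

(* Defs.v *)
(* Set is modelled by Rocq's Type; equality of morphisms is
   Leibniz equality of functions. *)
Set Implicit Arguments.

Section Defs.
Variable T : Type -> Type.
Variable eta : forall X : Type, X -> T X.
Variable bind : forall X Y : Type, (X -> T Y) -> T X -> T Y.

Definition copair {A B C : Type} (f : A -> C) (g : B -> C) : A + B -> C :=
  fun s => match s with inl a => f a | inr b => g b end.

Definition kcomp {X Y Z : Type} (g : Y -> T Z) (f : X -> T Y) : X -> T Z :=
  fun x => bind g (f x).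

Definition Tmap {X Y : Type} (f : X -> Y) : T X -> T Y :=
  bind (fun x => eta (f x)).

Definition sum_map {A B C D : Type} (f : A -> C) (g : B -> D) : A + B -> C + D :=
  copair (fun a => inl (f a)) (fun b => inr (g b)).

Definition is_monad : Prop :=
  (forall X : Type, bind (@eta X) = fun t => t) /\
  (forall (X Y : Type) (f : X -> T Y), (fun x => bind f (eta x)) = f) /\
  (forall (X Y Z : Type) (f : X -> T Y) (g : Y -> T Z),
      (fun t => bind g (bind f t)) = bind (kcomp g f)).

Variable dagger : forall X Y : Type, (X -> T (Y + X)) -> X -> T Y.

Definition delta (X Y : Type) : X -> T Y :=
  dagger (fun x : X => eta (@inr Y X x)).

Definition fixpoint_law : Prop :=
  forall (X Y : Type) (f : X -> T (Y + X)),
    kcomp (copair (@eta Y) (dagger f)) f = dagger f.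

Definition naturality_law : Prop :=
  forall (X Y Z : Type) (g : Y -> T Z) (f : X -> T (Y + X)),
    kcomp g (dagger f) =
    dagger (kcomp (copair (fun y => Tmap (@inl Z X) (g y))
                          (fun x => eta (@inr Z X x))) f).

Definition codiagonal_law : Prop :=
  forall (X Y : Type) (f : X -> T ((Y + X) + X)),
    dagger (dagger f) =
    dagger (kcomp (copair (@eta (Y + X)) (fun x => eta (@inr Y X x))) f).

Definition uniformity_law : Prop :=
  forall (X Y Z : Type) (h : X -> Z) (g : Z -> T (Y + Z)) (f : X -> T (Y + X)),
    (fun x => g (h x)) = (fun x => Tmap (sum_map (fun y : Y => y) h) (f x)) ->
    (fun x => dagger g (h x)) = dagger f.

Definition is_elgot_monad : Prop :=
  is_monad /\ fixpoint_law /\ naturality_law /\ codiagonal_law /\ uniformity_law.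

Definition strong_uniformity : Prop :=
  forall (X Y Z : Type) (h : X -> T Z) (g : Z -> T (Y + Z)) (f : X -> T (Y + X)),
    kcomp (@delta Z Y) h = @delta X Y ->
    kcomp g h = kcomp (copair (fun y => eta (@inl Y Z y))
                              (kcomp (fun z => eta (@inr Y Z z)) h)) f ->
    kcomp (dagger g) h = dagger f.

Variable join : forall X Y : Type, (X -> T Y) -> (X -> T Y) -> (X -> T Y).
Variable bot : forall X Y : Type, X -> T Y.

Definition is_enriched : Prop :=
  (forall (X Y : Type) (f g h : X -> T Y), join f (join g h) = join (join f g) h) /\
  (forall (X Y : Type) (f g : X -> T Y), join f g = join g f) /\
  (forall (X Y : Type) (f : X -> T Y), join f f = f) /\
  (forall (X Y : Type) (f : X -> T Y), join (@bot X Y) f = f) /\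
  (forall (X Y Z : Type) (g : Y -> T Z) (f1 f2 : X -> T Y),
      kcomp g (join f1 f2) = join (kcomp g f1) (kcomp g f2)) /\
  (forall (X Y Z : Type) (g1 g2 : Y -> T Z) (f : X -> T Y),
      kcomp (join g1 g2) f = join (kcomp g1 f) (kcomp g2 f)) /\
  (forall (X Y Z : Type) (g : Y -> T Z), kcomp g (@bot X Y) = @bot X Z) /\
  (forall (X Y Z : Type) (f : X -> T Y), kcomp (@bot Y Z) f = @bot X Z).

End Defs.

(* Main.v *)
Require Import Defs.
From Stdlib Require Import FunctionalExtensionality PropExtensionality ProofIrrelevance Lia.

(* The counterexample is the filter monad on Set, where filters may be
   improper (contain the empty set).  The improper filter models divergence
   and is the least element of the Kleisli hom-sets, whose order is reverse
   inclusion: the join of two Kleisli maps is the pointwise intersection of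
   filters.  Iteration [f^dagger x] is the filter of all V such that x lies in
   the greatest set S with "V + S eventually holds along f z" for all z in S.

   Strong uniformity fails for
   h = the Frechet filter on nat, g = the countdown n+1 |-> n, 0 |-> exit,
   f = the divergent loop on unit: g^dagger terminates on every n, so
   g^dagger . h is proper, whereas f^dagger is the improper filter. *)

Section GreatestFixpoints.
Variable X : Type.
Implicit Types P Q : (X -> Prop) -> X -> Prop.

Definition gfp P (x : X) : Prop := exists S : X -> Prop, S x /\ forall z, S z -> P S z.

Definition monotone P : Prop :=
  forall S S' : X -> Prop, (forall z, S z -> S' z) -> forall z, P S z -> P S' z.

Lemma gfp_coind P (S : X -> Prop) x : S x -> (forall z, S z -> P S z) -> gfp P x.
Proof. intros Sx HS; exists S; auto. Qed.

Lemma gfp_unfold P x : monotone P -> gfp P x -> P (gfp P) x.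
Proof.
  intros Hm [S [Sx HS]]. apply (Hm S); [intros z Sz; now apply (gfp_coind P S) | auto].
Qed.

Lemma gfp_fold P x : monotone P -> P (gfp P) x -> gfp P x.
Proof.
  intros Hm Hx. apply (gfp_coind P (P (gfp P))); [exact Hx |].
  intros z Hz. apply (Hm (gfp P)); [intros w Hw; now apply gfp_unfold | exact Hz].
Qed.

Lemma gfp_ext P Q x : (forall S z, P S z <-> Q S z) -> (gfp P x <-> gfp Q x).
Proof.
  intro H; split; intros [S [Sx HS]]; apply (gfp_coind _ S); auto; intros z Hz; apply H; auto.
Qed.

Lemma gfp_diagonal (P : (X -> Prop) -> (X -> Prop) -> X -> Prop) x :
  (forall S, monotone (P S)) ->
  (forall T S S', (forall z, S z -> S' z) -> forall z, P S T z -> P S' T z) ->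
  (gfp (fun S => gfp (P S)) x <-> gfp (fun S => P S S) x).
Proof.
  intros Hm2 Hm1; set (D := gfp (fun S => P S S)).
  assert (HD : forall z, D z -> P D D z).
  { intros z Hz. apply (gfp_unfold (fun S => P S S) z); [| exact Hz].
    intros S S' HS w Hw. exact (Hm1 S' S S' HS w (Hm2 S S S' HS w Hw)). }
  assert (Houter : monotone (fun S => gfp (P S))).
  { intros S S' HS w [U [Uw HU]]. apply (gfp_coind _ U); [exact Uw |].
    intros u Uu. exact (Hm1 U S S' HS u (HU u Uu)). }
  split.
  - intros Hx; set (L := gfp (fun S => gfp (P S))) in *.
    apply (gfp_coind _ L); [exact Hx |]. intros z Hz.
    apply (Hm2 L (gfp (P L))); [intros w Hw; now apply gfp_fold |].
    apply gfp_unfold; [apply Hm2 | now apply (gfp_unfold (fun S => gfp (P S)))].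
  - intro Hx. apply (gfp_coind _ D); [exact Hx |].
    intros z Hz. apply (gfp_coind _ D); [exact Hz | exact HD].
Qed.
End GreatestFixpoints.
Arguments gfp {X}. Arguments monotone {X}.
Arguments gfp_coind {X} P S {x}. Arguments gfp_unfold {X}. Arguments gfp_fold {X}.

Lemma gfp_transfer {X Z : Type} (h : X -> Z) (Q : (Z -> Prop) -> Z -> Prop)
      (P : (X -> Prop) -> X -> Prop) :
  monotone Q -> monotone P ->
  (forall S x, Q S (h x) <-> P (fun x' => S (h x')) x) ->
  forall x, gfp Q (h x) <-> gfp P x.
Proof.
  intros HQ HP Hh x; split.
  - intro Hx. apply (gfp_coind P (fun x' => gfp Q (h x'))); [exact Hx |].
    intros x' Hx'. apply Hh, gfp_unfold; assumption.
  - intro Hx. apply (gfp_coind Q (fun z => exists x', z = h x' /\ gfp P x')); [eauto |].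
    intros z [x' [-> Hx']]. apply Hh.
    apply (HP (gfp P)); [intros w Hw; eauto | now apply gfp_unfold].
Qed.

(* Filters on [X], possibly improper: upward closed families of predicates,
   closed under binary intersection and containing the full set.
   [contains F V] reads "V holds F-eventually". *)
Record filt (X : Type) : Type := mkFilt {
  contains : (X -> Prop) -> Prop;
  contains_full : contains (fun _ => True);
  contains_meet : forall V W : X -> Prop,
      contains (fun x => V x /\ W x) <-> (contains V /\ contains W) }.
Arguments mkFilt {X}. Arguments contains {X}.
Arguments contains_full {X}. Arguments contains_meet {X}.

Lemma filt_eq {X} (F G : filt X) : (forall V, contains F V <-> contains G V) -> F = G.
Proof.
  destruct F as [p1 t1 m1], G as [p2 t2 m2]; simpl; intro H.
  assert (p1 = p2) by (extensionality V; apply propositional_extensionality, H).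
  subst p2. f_equal; apply proof_irrelevance.
Qed.

(* Upward closure follows from closure under meets. *)
Lemma contains_mono {X} (F : filt X) (V W : X -> Prop) :
  (forall x, V x -> W x) -> contains F V -> contains F W.
Proof.
  intros H HV.
  assert (E : (fun x => V x /\ W x) = V).
  { extensionality x; apply propositional_extensionality; firstorder. }
  pose proof (proj1 (contains_meet F V W)) as M. rewrite E in M. exact (proj2 (M HV)).
Qed.

Lemma contains_ext {X} (F : filt X) V W :
  (forall x, V x <-> W x) -> (contains F V <-> contains F W).
Proof. intro H; split; apply contains_mono; firstorder. Qed.

Definition feta (X : Type) (x : X) : filt X :=
  mkFilt (fun V => V x) I (fun V W => iff_refl _).

Definition fbind (X Y : Type) (f : X -> filt Y) (F : filt X) : filt Y.
Proof.
  refine (mkFilt (fun V => contains F (fun x => contains (f x) V)) _ _).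
  - apply (contains_mono F (fun _ => True)); [intros x _; apply contains_full | apply contains_full].
  - intros V W. rewrite <- (contains_meet F). apply contains_ext. intro x. apply contains_meet.
Defined.

(* All three monad laws hold definitionally on members. *)
Lemma filt_monad : is_monad filt feta fbind.
Proof.
  split; [| split]; intros; extensionality t; now apply filt_eq.
Qed.

Definition fjoin (X Y : Type) (f g : X -> filt Y) (x : X) : filt Y.
Proof.
  refine (mkFilt (fun V => contains (f x) V /\ contains (g x) V)
                 (conj (contains_full _) (contains_full _)) _).
  intros V W. rewrite (contains_meet (f x)), (contains_meet (g x)). tauto.
Defined.

Definition fbot (X Y : Type) (x : X) : filt Y :=
  mkFilt (fun _ => True) I (fun V W => conj (fun _ => conj I I) (fun _ => I)).

Lemma filt_enriched : is_enriched filt fbind fjoin fbot.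
Proof.
  repeat split; intros.
  all: try (extensionality x; apply filt_eq; intro V; simpl; tauto).
  - extensionality x; apply filt_eq; intro V. exact (contains_meet (f x) _ _).
  - extensionality x; apply filt_eq; intro V. simpl. split; auto. intros _. apply contains_full.
Qed.

Definition loop_step {X Y} (f : X -> filt (Y + X)) (V : Y -> Prop) :
  (X -> Prop) -> X -> Prop := fun S z => contains (f z) (copair V S).

Lemma loop_step_mono {X Y} (f : X -> filt (Y + X)) V : monotone (loop_step f V).
Proof. intros S S' H z. apply contains_mono. intros [y | x']; simpl; auto. Qed.

(* Iteration: the greatest fixpoint of [loop_step]; meets are preserved
   since post-fixpoints are closed under intersection. *)
Definition fdag (X Y : Type) (f : X -> filt (Y + X)) (x : X) : filt Y.
Proof.
  refine (mkFilt (fun V => gfp (loop_step f V) x) _ _).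
  - apply (gfp_coind _ (fun _ => True)); [exact I |]. intros z _.
    apply (contains_mono _ (fun _ => True)); [intros [y | x'] _; exact I | apply contains_full].
  - intros V W; split.
    + intros [S [Sx HS]]; split; apply (gfp_coind _ S Sx); intros z Hz;
        refine (contains_mono _ _ _ _ (HS z Hz)); intros [y | x']; simpl; tauto.
    + intros [[S1 [H1 K1]] [S2 [H2 K2]]].
      apply (gfp_coind _ (fun z => S1 z /\ S2 z)); [auto |]. intros z [a b].
      apply (contains_mono _ (fun s => copair V S1 s /\ copair W S2 s)).
      * intros [y | x']; simpl; tauto.
      * apply contains_meet. split; [apply K1 | apply K2]; auto.
Defined.

(* Fixpoint law: fold/unfold of the greatest fixpoint. *)
Lemma fdag_fixpoint : fixpoint_law filt feta fbind fdag.
Proof.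
  intros X Y f. extensionality x. apply filt_eq. intro V.
  change (contains (f x) (fun s => contains (copair (feta Y) (fdag X Y f) s) V)
          <-> gfp (loop_step f V) x).
  transitivity (loop_step f V (gfp (loop_step f V)) x).
  - apply contains_ext. intros [y | x']; reflexivity.
  - split; [apply gfp_fold | apply gfp_unfold]; apply loop_step_mono.
Qed.

(* Naturality: both sides unfold to the same loop step. *)
Lemma fdag_naturality : naturality_law filt feta fbind fdag.
Proof.
  intros X Y Z g f. extensionality x. apply filt_eq. intro V.
  apply gfp_ext. intros S z. unfold loop_step; cbn.
  apply contains_ext. intros [y | x']; reflexivity.
Qed.

(* Codiagonal: an instance of the diagonal rule for greatest fixpoints. *)
Lemma fdag_codiagonal : codiagonal_law filt feta fbind fdag.
Proof.
  intros X Y f. extensionality x. apply filt_eq. intro V.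
  set (P := fun (S T : X -> Prop) w => contains (f w) (copair (copair V S) T)).
  transitivity (gfp (fun S => gfp (P S)) x).
  { apply gfp_ext. intros S z. apply gfp_ext. intros T w. unfold loop_step, P; cbn.
    apply contains_ext. intros [[y | x1] | x2]; reflexivity. }
  transitivity (gfp (fun S => P S S) x).
  { apply gfp_diagonal.
    - intros S T T' H w. apply contains_mono. intros [[y | x1] | x2]; simpl; auto.
    - intros T S S' H w. apply contains_mono. intros [[y | x1] | x2]; simpl; auto. }
  apply gfp_ext. intros S z. unfold loop_step, P; cbn.
  apply contains_ext. intros [[y | x1] | x2]; reflexivity.
Qed.

(* Uniformity: an instance of transfer of greatest fixpoints along [h]. *)
Lemma fdag_uniformity : uniformity_law filt feta fbind fdag.
Proof.
  intros X Y Z h g f Hgf. extensionality x. apply filt_eq. intro V.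
  apply (gfp_transfer h (loop_step g V) (loop_step f V)); try apply loop_step_mono.
  intros S x'. unfold loop_step. rewrite (equal_f Hgf x'); cbn.
  apply contains_ext. intros [y | x2]; reflexivity.
Qed.

Lemma filt_elgot : is_elgot_monad filt feta fbind fdag.
Proof.
  repeat split; first [ apply filt_monad | apply fdag_fixpoint | apply fdag_naturality
                      | apply fdag_codiagonal | apply fdag_uniformity ].
Qed.

(* Iterating the nondeterministic choice between exiting and looping yields
   the unit: the exit is eventually taken on every branch. *)
Lemma fdag_choice (X : Type) :
  fdag X X (fjoin X (X + X) (fun x => feta (X + X) (inl x))
                            (fun x => feta (X + X) (inr x))) = feta X.
Proof.
  extensionality x. apply filt_eq. intro V. split.
  - intros [S [Sx H]]. exact (proj1 (H x Sx)).
  - intro Hv. apply (gfp_coind _ V Hv). intros z Hz. split; exact Hz.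
Qed.

Definition frechet : filt nat.
Proof.
  refine (mkFilt (fun W => exists N, forall n, N <= n -> W n) (ex_intro _ 0 (fun _ _ => I)) _).
  intros V W; split.
  - intros [N H]; split; exists N; intros n Hn; apply H; auto.
  - intros [[N1 H1] [N2 H2]]. exists (N1 + N2). intros n Hn.
    split; [apply H1 | apply H2]; lia.
Defined.

Definition countdown (n : nat) : filt (unit + nat) :=
  match n with 0 => feta _ (inl tt) | S m => feta _ (inr m) end.

Lemma delta_improper (X Y : Type) (x : X) (V : Y -> Prop) :
  contains (@delta filt feta fdag X Y x) V.
Proof. apply (gfp_coind _ (fun _ => True)); [exact I | intros z _; exact I]. Qed.

(* Running one countdown step from a Frechet-random start is again
   Frechet-random (tagged as a continuation). *)
Lemma countdown_frechet :
  kcomp filt fbind countdown (fun _ : unit => frechet) =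
  kcomp filt fbind (copair (fun y => feta _ (@inl unit nat y))
                           (kcomp filt fbind (fun z => feta _ (@inr unit nat z))
                                  (fun _ : unit => frechet)))
        (fun u : unit => feta _ (@inr unit unit u)).
Proof.
  extensionality x. apply filt_eq. intro W. simpl. split.
  - intros [N H]. exists N. intros n Hn. apply (H (S n)). lia.
  - intros [N H]. exists (S N). intros [| n] Hn; [lia |]. apply H. lia.
Qed.

Lemma countdown_terminates (n : nat) : ~ contains (fdag nat unit countdown n) (fun _ => False).
Proof.
  induction n as [| n IHn]; intro H;
    apply (gfp_unfold _ _ (loop_step_mono countdown _)) in H.
  - exact H.
  - exact (IHn H).
Qed.

(* Strong uniformity would force the proper filter g^dagger . h to equal the
   improper filter delta. *)
Lemma filt_not_strongly_uniform : ~ strong_uniformity filt feta fbind fdag.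
Proof.
  intro SU.
  assert (E : kcomp filt fbind (fdag nat unit countdown) (fun _ : unit => frechet) =
              @delta filt feta fdag unit unit).
  { apply SU; [| exact countdown_frechet].
    extensionality x. apply filt_eq. intro V. split; intros _; [apply delta_improper |].
    apply (contains_mono frechet (fun _ => True));
      [intros; apply delta_improper | apply contains_full]. }
  assert (Hloop := delta_improper unit unit tt (fun _ => False)).
  rewrite <- E in Hloop. destruct Hloop as [N HN].
  exact (countdown_terminates N (HN N (le_n N))).
Qed.

Theorem mainTheorem9 :
  exists (T : Type -> Type) (eta : forall X : Type, X -> T X)
         (bind : forall X Y : Type, (X -> T Y) -> T X -> T Y)
         (dagger : forall X Y : Type, (X -> T (Y + X)%type) -> X -> T Y)
         (join : forall X Y : Type, (X -> T Y) -> (X -> T Y) -> (X -> T Y))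
         (bot : forall X Y : Type, X -> T Y),
    is_elgot_monad T eta bind dagger /\
    is_enriched T bind join bot /\
    (forall X : Type,
        dagger X X (join X (X + X)%type
                         (fun x : X => eta (X + X)%type (inl x))
                         (fun x : X => eta (X + X)%type (inr x))) = eta X) /\
    ~ strong_uniformity T eta bind dagger.
Proof.
  exists filt, feta, fbind, fdag, fjoin, fbot.
  split; [exact filt_elgot |].
  split; [exact filt_enriched |].
  split; [exact fdag_choice | exact filt_not_strongly_uniform].
Qed.
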